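(* Let $\nu>0$ and $\lambda,\mu>0$, let $\alpha,\beta\in\mathbb{R}$, put $p=\lambda/\mu$, and assume that either $\alpha>\beta$, or $\alpha=\beta$ and $0<p<1$. Consider a single-server queuing system in which, when there are $k$ units in the system, the arrival rate is $\lambda_k=(\nu+k)^{\beta}\lambda$ ($k\ge 0$) and the service rate is $\mu_k=k^{\alpha}\mu$ ($k\ge 1$). Let $(P_k)_{k\ge 0}$ be a steady-state probability distribution of the number of units in the system, i.e. $P_k\ge 0$, $\sum_{k\ge 0}P_k=1$, and $$0=-\lambda\nu^{\beta}P_0+\mu P_1,$$ $$0=\lambda(\nu+k-1)^{\beta}P_{k-1}-\bigl(\lambda(\nu+k)^{\beta}+\mu k^{\alpha}\bigr)P_k+\mu(k+1)^{\alpha}P_{k+1},\qquad k=1,2,\dots$$ Then $(P_k)_{k\ge 0}$ is the probability mass function of the $\mathrm{ECOMP}(\nu,p,\alpha,\beta)$ distribution, that is, for every $k\ge 0$, $$P_k=\frac{\{(\nu)_k\}^{\beta}}{(k!)^{\alpha}}\,p^k\Bigg/\sum_{i=0}^{\infty}\frac{\{(\nu)_i\}^{\beta}}{(i!)^{\alpha}}\,p^i .$$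
   Context: $(\nu)_k=\nu(\nu+1)\cdots(\nu+k-1)$, with $(\nu)_0=1$, is the Pochhammer symbol. The extended Conway-Maxwell-Poisson distribution $\mathrm{ECOMP}(\nu,p,\alpha,\beta)$ is the distribution on $\{0,1,2,\dots\}$ with probability mass function $P(X=k)=\frac{\{(\nu)_k\}^{\beta}}{(k!)^{\alpha}}p^k\big/\sum_{i=0}^{\infty}\frac{\{(\nu)_i\}^{\beta}}{(i!)^{\alpha}}p^i$, with parameters satisfying $\nu>0$ and either $p>0$, $\alpha>\beta$, or $0<p<1$, $\alpha=\beta$. The steady-state equations are the differential-difference equations of the state-dependent queue with all time derivatives set to zero. *)

(* Defs.v *)
From Stdlib Require Import Reals Arith Factorial.
From Coquelicot Require Import Coquelicot.
Open Scope R_scope.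

Fixpoint pochhammer (nu : R) (k : nat) : R :=
  match k with
  | O => 1
  | S j => pochhammer nu j * (nu + INR j)
  end.

(* [Rpower x y] is the real power x^y for x > 0.  Every base occurring below
   is positive once nu > 0, except in [service_rate alpha mu 0], which the
   steady-state equations never use. *)

Definition ecomp_weight (nu p alpha beta : R) (k : nat) : R :=
  Rpower (pochhammer nu k) beta / Rpower (INR (fact k)) alpha * p ^ k.

(* [Series] takes a junk value on divergent series, so statements about
   [ecomp_pmf] should be accompanied by [ex_series (ecomp_weight _ _ _ _)]. *)
Definition ecomp_pmf (nu p alpha beta : R) (k : nat) : R :=
  ecomp_weight nu p alpha beta k / Series (ecomp_weight nu p alpha beta).

Definition is_pmf (P : nat -> R) : Prop :=
  (forall k, 0 <= P k) /\ is_series P 1.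

Definition arrival_rate (nu beta lambda : R) (k : nat) : R :=
  Rpower (nu + INR k) beta * lambda.

Definition service_rate (alpha mu : R) (k : nat) : R :=
  Rpower (INR k) alpha * mu.

(* The value of dP_k/dt prescribed by the differential-difference equations of
   a single-server queue with arrival rates [l k] (k >= 0) and service rates
   [m k] (k >= 1). *)
Definition queue_drift (l m : nat -> R) (P : nat -> R) (k : nat) : R :=
  match k with
  | O => - l 0%nat * P 0%nat + m 1%nat * P 1%nat
  | S j => l j * P j - (l k + m k) * P k + m (S k) * P (S k)
  end.

Definition steady_state (l m : nat -> R) (P : nat -> R) : Prop :=
  forall k, 0 = queue_drift l m P k.

Lemma steady_state_explicit (nu lambda mu alpha beta : R) (P : nat -> R) :
  steady_state (arrival_rate nu beta lambda) (service_rate alpha mu) P <->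
  0 = - lambda * Rpower nu beta * P 0%nat + mu * P 1%nat /\
  (forall k : nat, (1 <= k)%nat ->
     0 = lambda * Rpower (nu + INR k - 1) beta * P (k - 1)%nat
         - (lambda * Rpower (nu + INR k) beta + mu * Rpower (INR k) alpha) * P k
         + mu * Rpower (INR k + 1) alpha * P (k + 1)%nat).
Proof.
assert (H1 : Rpower 1 alpha = 1).
{ unfold Rpower; rewrite ln_1, Rmult_0_r; apply exp_0. }
assert (E0 : queue_drift (arrival_rate nu beta lambda) (service_rate alpha mu) P 0
           = - lambda * Rpower nu beta * P 0%nat + mu * P 1%nat).
{ unfold queue_drift, arrival_rate, service_rate.
  change (INR 0) with 0; change (INR 1) with 1.
  rewrite H1, Rplus_0_r; ring. }
assert (ES : forall j,
  queue_drift (arrival_rate nu beta lambda) (service_rate alpha mu) P (S j)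
  = lambda * Rpower (nu + INR (S j) - 1) beta * P (S j - 1)%nat
    - (lambda * Rpower (nu + INR (S j)) beta + mu * Rpower (INR (S j)) alpha) * P (S j)
    + mu * Rpower (INR (S j) + 1) alpha * P (S j + 1)%nat).
{ intro j; unfold queue_drift, arrival_rate, service_rate.
  replace (S j - 1)%nat with j by (simpl; now rewrite Nat.sub_0_r).
  rewrite Nat.add_1_r, (S_INR (S j)).
  replace (nu + INR (S j) - 1) with (nu + INR j) by (rewrite S_INR; ring).
  ring. }
split.
- intro H; split.
  + rewrite <- E0; apply H.
  + intros [|j] Hk; [inversion Hk | rewrite <- ES; apply H].
- intros [HA HB] [|j].
  + now rewrite E0.
  + rewrite ES; apply HB; apply le_n_S, Nat.le_0_l.
Qed.

(* Main.v *)
Require Import Defs.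
From Stdlib Require Import Reals Arith Factorial Lra.
From Coquelicot Require Import Coquelicot.
Open Scope R_scope.

(** Summing the first [k + 1] steady-state equations telescopes to the detailed
    balance relation [mu_{k+1} P_{k+1} = lambda_k P_k].  The ECOMP weights [w]
    satisfy the same recursion with [w_0 = 1], so [P = P_0 w].  Since [P] sums
    to 1, [P_0] is nonzero; hence [w] is summable with sum [1 / P_0], without
    any direct convergence estimate. *)

Lemma steady_state_detailed_balance (l m P : nat -> R) :
  steady_state l m P -> forall k, m (S k) * P (S k) = l k * P k.
Proof.
intros H k; induction k as [|k IH].
- generalize (H 0%nat); simpl; lra.
- generalize (H (S k)); simpl; simpl in IH; lra.
Qed.

Lemma pochhammer_pos (nu : R) (k : nat) : 0 < nu -> 0 < pochhammer nu k.
Proof.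
intro hnu; induction k as [|k IH]; simpl.
- exact Rlt_0_1.
- apply Rmult_lt_0_compat; [exact IH|].
  generalize (pos_INR k); lra.
Qed.

Lemma Rpower_1_l (y : R) : Rpower 1 y = 1.
Proof. unfold Rpower; rewrite ln_1, Rmult_0_r; apply exp_0. Qed.

Lemma ecomp_weight_0 (nu p alpha beta : R) : ecomp_weight nu p alpha beta 0 = 1.
Proof. unfold ecomp_weight; simpl; rewrite !Rpower_1_l; field. Qed.

(** Consecutive weights have ratio (nu + k)^beta / (k + 1)^alpha * lambda / mu, the arrival rate at
    k over the service rate at k + 1. *)
Lemma ecomp_weight_detailed_balance (nu lambda mu alpha beta : R) (k : nat) :
  0 < nu -> 0 < mu ->
  service_rate alpha mu (S k) * ecomp_weight nu (lambda / mu) alpha beta (S k)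
  = arrival_rate nu beta lambda k * ecomp_weight nu (lambda / mu) alpha beta k.
Proof.
intros hnu hmu; unfold service_rate, arrival_rate, ecomp_weight.
rewrite fact_simpl, mult_INR.
simpl pochhammer; rewrite <- tech_pow_Rmult.
assert (hSk : 0 < INR (S k)) by apply lt_0_INR, Nat.lt_0_succ.
assert (hnk : 0 < nu + INR k) by (generalize (pos_INR k); lra).
(* Splitting a real power of a product requires both factors to be positive. *)
rewrite <- (Rpower_mult_distr (INR (S k))) by (auto using INR_fact_lt_0).
rewrite <- Rpower_mult_distr by (auto using pochhammer_pos).
assert (Rpower (INR (S k)) alpha <> 0) by apply Rgt_not_eq, exp_pos.
assert (Rpower (INR (fact k)) alpha <> 0) by apply Rgt_not_eq, exp_pos.
field; repeat split; auto; lra.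
Qed.

Lemma steady_state_ecomp_weight (nu lambda mu alpha beta : R) (P : nat -> R) :
  0 < nu -> 0 < mu ->
  steady_state (arrival_rate nu beta lambda) (service_rate alpha mu) P ->
  forall k, P k = P 0%nat * ecomp_weight nu (lambda / mu) alpha beta k.
Proof.
intros hnu hmu H k; induction k as [|k IH].
- rewrite ecomp_weight_0; ring.
- apply (Rmult_eq_reg_l (service_rate alpha mu (S k))).
  + rewrite (steady_state_detailed_balance _ _ _ H), IH.
    transitivity (P 0%nat * (arrival_rate nu beta lambda k
                             * ecomp_weight nu (lambda / mu) alpha beta k));
      [ring|].
    rewrite <- ecomp_weight_detailed_balance by assumption; ring.
  + apply Rgt_not_eq, Rmult_lt_0_compat; [apply exp_pos | exact hmu].
Qed.

Lemma is_series_normalize (P w : nat -> R) (c : R) :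
  (forall k, P k = c * w k) -> is_series P 1 ->
  ex_series w /\ forall k, P k = w k / Series w.
Proof.
intros HP HS.
assert (Hc : c <> 0).
{ intro Hc.
  (* [Series_scal_l] needs no convergence, so c = 0 would give 1 = 0 * [Series w] even though [w] is
     not yet known to be summable. *)
  assert (E : Series P = 0 * Series w).
  { rewrite <- Series_scal_l; apply Series_ext; intro n; now rewrite HP, Hc. }
  rewrite (is_series_unique _ _ HS) in E; lra. }
assert (Hw : is_series w (/ c)).
{ replace (/ c) with (/ c * 1) by ring.
  apply is_series_ext with (fun n => / c * P n).
  - intro n; change (/ c * P n = w n); rewrite HP; now field.
  - exact (is_series_scal (/ c) P 1 HS). }
split.
- now exists (/ c).
- intro k; rewrite (is_series_unique _ _ Hw), HP; now field.
Qed.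

Theorem mainTheorem1 (nu lambda mu alpha beta p : R)
  (hnu : 0 < nu) (hlambda : 0 < lambda) (hmu : 0 < mu)
  (hp : p = lambda / mu)
  (hpar : alpha > beta \/ (alpha = beta /\ 0 < p < 1))
  (P : nat -> R)
  (hP : is_pmf P)
  (hsteady : steady_state (arrival_rate nu beta lambda) (service_rate alpha mu) P) :
  ex_series (ecomp_weight nu p alpha beta) /\
  forall k : nat, P k = ecomp_pmf nu p alpha beta k.
Proof.
subst p.
(* The proportionality constant is [P 0] because the weight at 0 is 1. *)
apply is_series_normalize with (P 0%nat).
- now apply steady_state_ecomp_weight.
- apply hP.
Qed.
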